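(* Let $M,H$ be $3$-Lie algebras over a field $\mathbb F$ with $\operatorname{char}\mathbb F\ne2$, let $A=M\dot+H$ be a $(\mu,\rho,\beta)$-extension of $H$ by $M$ which is a $3$-Lie algebra, and let $(\sigma,\tau)\in\operatorname{Der}(M)\times\operatorname{Der}(H)$. Then $(\sigma,\tau)$ can be extended to a derivation of $A$ if and only if the pair of $3$-Lie homomorphisms $(f_\sigma,f_\tau)$ can be extended to a $3$-Lie homomorphism from $A$ to $A^3$.
   Context: A $3$-Lie algebra is a vector space with a trilinear skew-symmetric bracket satisfying $[[x,y,z],u,v]=[[x,u,v],y,z]+[x,[y,u,v],z]+[x,y,[z,u,v]]$. A derivation is a linear map $d$ with $d[x,y,z]=[dx,y,z]+[x,dy,z]+[x,y,dz]$; $\operatorname{Der}$ denotes the space of derivations. A $3$-Lie homomorphism is a linear map preserving the ternary brackets. $(\mu,\rho,\beta)$-extension: let $A=M\dot+H$ be the direct sum of vector spaces. Let $\rho:M\wedge M\to\operatorname{Der}(H)$ (skew-symmetric bilinear), $\beta:M\wedge H\to\operatorname{Der}(H)$ (bilinear in $(x,h)\in M\times H$, with the convention $\beta(h,x)=-\beta(x,h)$) and $\mu:M\wedge M\wedge M\to H$ (skew-symmetric trilinear) be linear maps. The $(\mu,\rho,\beta)$-extension of $H$ by $M$ is $A$ with the skew-symmetric trilinear bracket determined by $[x,y,z]_A=[x,y,z]_M+\mu(x,y,z)$, $[x,y,h]_A=\rho(x,y)h$, $[x,h_1,h_2]_A=\beta(x,h_1)h_2$, $[h_1,h_2,h_3]_A=[h_1,h_2,h_3]_H$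 for $x,y,z\in M$, $h,h_i\in H$ (so in particular $\beta(x,h_1)h_2=-\beta(x,h_2)h_1$). Let $i:H\to A$, $i(h)=h$, and $p:A\to M$, $p(x+h)=x$. For a $3$-Lie algebra $B$, $B^3=\{(x,y,z):x,y,z\in B\}$ denotes the $3$-Lie algebra with bracket $[(x_1,y_1,z_1),(x_2,y_2,z_2),(x_3,y_3,z_3)]=([x_1,y_2,y_3]+[x_2,y_3,y_1]+[x_3,y_1,y_2],\,[y_1,y_2,y_3],\,[z_1,z_2,z_3])$. For a derivation $d$ of $B$, $f_d:B\to B^3$ is $f_d(x)=(dx,x,x)$, which is a $3$-Lie homomorphism. $(\sigma,\tau)$ extends to a derivation $\delta$ of $A$ if $\delta\in\operatorname{Der}(A)$, $\delta\circ i=i\circ\tau$ and $p\circ\delta=\sigma\circ p$. The pair $(f_\sigma,f_\tau)$ extends to a $3$-Lie homomorphism $g:A\to A^3$ if $g\circ i=(i\times i\times i)\circ f_\tau$ and $(p\times p\times p)\circ g=f_\sigma\circ p$. *)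

(* Defs.v *)
From mathcomp Require Import all_boot all_order all_algebra.
Set Implicit Arguments.
Unset Strict Implicit.
Unset Printing Implicit Defensive.
Import GRing.Theory.
Local Open Scope ring_scope.

Definition trilinear (F : fieldType) (U1 U2 U3 V : lmodType F)
    (f : U1 -> U2 -> U3 -> V) : Prop :=
  [/\ forall y z, linear (fun x => f x y z),
      forall x z, linear (fun y => f x y z)
    & forall x y, linear (fun z => f x y z)].

Definition skew3 (F : fieldType) (U V : lmodType F) (f : U -> U -> U -> V) :
    Prop :=
  (forall x y z, f y x z = - f x y z) /\ (forall x y z, f x z y = - f x y z).

Definition fundamental_identity (F : fieldType) (V : lmodType F)
    (b : V -> V -> V -> V) : Prop :=
  forall x y z u v,
    b (b x y z) u v = b (b x u v) y z + b x (b y u v) z + b x y (b z u v).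

(* A 3-Lie algebra structure on the vector space [V]; no dimension bound. *)
Record threeLie (F : fieldType) (V : lmodType F) := ThreeLie {
  bracket :> V -> V -> V -> V;
  bracket_trilinear : trilinear bracket;
  bracket_skew : skew3 bracket;
  bracket_fundamental : fundamental_identity bracket
}.

Definition is_derivation (F : fieldType) (V : lmodType F) (B : threeLie V)
    (d : V -> V) : Prop :=
  linear d /\
  forall x y z, d (B x y z) = B (d x) y z + B x (d y) z + B x y (d z).

Definition is_threeLie_hom (F : fieldType) (V W : lmodType F)
    (B : threeLie V) (C : threeLie W) (f : V -> W) : Prop :=
  linear f /\ forall x y z, f (B x y z) = C (f x) (f y) (f z).

Section Triple.
Variables (F : fieldType) (V : lmodType F) (B : threeLie V).

(* ((x, y), z) : V * V * V stands for the triple (x, y, z). *)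
Definition triple_bracket (a b c : V * V * V) : V * V * V :=
  let: (x1, y1, z1) := a in
  let: (x2, y2, z2) := b in
  let: (x3, y3, z3) := c in
  (B x1 y2 y3 + B x2 y3 y1 + B x3 y1 y2, B y1 y2 y3, B z1 z2 z3).

Let lin1 a x x' y z : B (a *: x + x') y z = a *: B x y z + B x' y z.
Proof. by case: (bracket_trilinear B) => l _ _; rewrite (l y z). Qed.
Let lin2 a x x' y z : B y (a *: x + x') z = a *: B y x z + B y x' z.
Proof. by case: (bracket_trilinear B) => _ l _; rewrite (l y z). Qed.
Let lin3 a x x' y z : B y z (a *: x + x') = a *: B y z x + B y z x'.
Proof. by case: (bracket_trilinear B) => _ _ l; rewrite (l y z). Qed.
Let add1 x x' y z : B (x + x') y z = B x y z + B x' y z.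
Proof. by have := lin1 1 x x' y z; rewrite !scale1r. Qed.
Let sk12 x y z : B y x z = - B x y z.
Proof. by case: (bracket_skew B). Qed.
Let sk23 x y z : B x z y = - B x y z.
Proof. by case: (bracket_skew B). Qed.
Let cyc x y z : B x y z = B y z x.
Proof. by rewrite sk12 sk23 opprK. Qed.

Let tE x1 y1 z1 x2 y2 z2 x3 y3 z3 :
  triple_bracket (x1, y1, z1) (x2, y2, z2) (x3, y3, z3) =
  (B x1 y2 y3 + B x2 y3 y1 + B x3 y1 y2, B y1 y2 y3, B z1 z2 z3).
Proof. by []. Qed.

Lemma triple_trilinear : trilinear triple_bracket.
Proof.
have AC3 (a b c a' b' c' : V) k :
    (k *: a + a') + (k *: b + b') + (k *: c + c') =
    k *: (a + b + c) + (a' + b' + c').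
  by rewrite !scalerDr (addrACA (k *: a)) (addrACA (k *: a + k *: b)).
have E k (x y z x' y' z' : V) :
    k *: (x, y, z) + (x', y', z') = (k *: x + x', k *: y + y', k *: z + z').
  by [].
split=> [] [[x2 y2] z2] [[x3 y3] z3] k [[x y] z] [[x' y'] z'].
- by rewrite E !tE E !lin1 lin2 lin3 AC3.
- by rewrite E !tE E !lin2 lin1 lin3 AC3.
- by rewrite E !tE E !lin3 lin1 lin2 AC3.
Qed.

Lemma triple_skew : skew3 triple_bracket.
Proof.
have N (x y z : V) : - (x, y, z) = (- x, - y, - z) by [].
split=> [] [[x1 y1] z1] [[x2 y2] z2] [[x3 y3] z3]; rewrite !tE N !opprD.
- by rewrite (sk12 y1 y2) (sk12 z1 z2) (sk23 x1 y2) (sk23 x2 y3)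
    (sk23 x3 y1) (addrC (- B x2 y3 y1)).
- by rewrite (sk23 y1 y2) (sk23 z1 z2) -(sk23 x1) -(sk23 x2) -(sk23 x3) addrAC.
Qed.

Lemma triple_fundamental : fundamental_identity triple_bracket.
Proof.
have FI := bracket_fundamental B.
have D (x y z x' y' z' : V) :
  (x, y, z) + (x', y', z') = (x + x', y + y', z + z') by [].
move=> [[x1 y1] z1] [[x2 y2] z2] [[x3 y3] z3] [[x4 y4] z4] [[x5 y5] z5].
rewrite !tE !D (FI y1) (FI z1).
set L := (X in (X, _, _) = _). set R := (X in _ = (X, _, _)).
suff -> : L = R by [].
rewrite /L /R {L R}.
rewrite [B x4 y5 (B y1 y2 y3)]cyc [B y5 (B y1 y2 y3) x4]cyc.
rewrite [B x5 (B y1 y2 y3) y4]cyc !add1.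
rewrite (FI x1 y2 y3) (FI x2 y3 y1) (FI x3 y1 y2).
rewrite (FI y1 y2 y3 x4 y5) (FI y1 y2 y3 y4 x5).
rewrite (cyc x4 y5 y1) (cyc x4 y5 y2) (cyc x4 y5 y3).
rewrite (cyc y5 y1 x4) (cyc y5 y2 x4) (cyc y5 y3 x4).
rewrite (cyc x5 y1 y4) (cyc x5 y2 y4) (cyc x5 y3 y4).
rewrite (cyc y1 (B y2 x4 y5)) (cyc y1 (B y2 y4 x5)).
rewrite (cyc (B y3 x4 y5)) (cyc (B y3 y4 x5)).
rewrite /= -!addrA.
do 14?[match goal with |- ?a + _ = _ =>
  rewrite ?[in RHS](addrC _ a) -?addrA;
  do ?rewrite [in RHS](addrCA _ a); congr (_ + _)
end].
Qed.

Definition triple : threeLie (V * V * V)%type :=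
  ThreeLie triple_trilinear triple_skew triple_fundamental.

Definition f_der (d : V -> V) (x : V) : V * V * V := (d x, x, x).

Lemma f_der_hom (d : V -> V) :
  is_derivation B d -> is_threeLie_hom B triple (f_der d).
Proof.
move=> [dlin dB]; split=> [k x y | x y z]; first by rewrite /f_der dlin.
have -> : triple (f_der d x) (f_der d y) (f_der d z) =
  (B (d x) y z + B (d y) z x + B (d z) x y, B x y z, B x y z) by [].
by rewrite /f_der dB (cyc x (d y) z) (cyc x y (d z)) (cyc y (d z) x).
Qed.

End Triple.

Section Extension.
Variables (F : fieldType) (V W : lmodType F) (M : threeLie V) (H : threeLie W).

(* rho and beta are curried: linearity in their last argument is linearity of
   the operators rho(x, y) and beta(x, h). The identity
   beta(x, h1) h2 = - beta(x, h2) h1 is not required here: it follows from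
   the skew-symmetry of the bracket of A in [is_extension]. *)
Record extData := ExtData {
  mu : V -> V -> V -> W;
  rho : V -> V -> W -> W;
  beta : V -> W -> W -> W;
  mu_trilinear : trilinear mu;
  mu_skew : skew3 mu;
  rho_trilinear : trilinear rho;
  rho_skew : forall x y h, rho y x h = - rho x y h;
  rho_der : forall x y, is_derivation H (rho x y);
  beta_trilinear : trilinear beta;
  beta_der : forall x h, is_derivation H (beta x h)
}.

(* The underlying space of A is V * W; (x, h) stands for x + h. As A is
   trilinear and skew-symmetric, these equations determine its bracket. *)
Definition is_extension (E : extData) (A : threeLie (V * W)%type) : Prop :=
  [/\ forall x y z, A (x, 0) (y, 0) (z, 0) = (M x y z, mu E x y z),
      forall x y h, A (x, 0) (y, 0) (0, h) = (0, rho E x y h),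
      forall x h1 h2, A (x, 0) (0, h1) (0, h2) = (0, beta E x h1 h2)
    & forall h1 h2 h3, A (0, h1) (0, h2) (0, h3) = (0, H h1 h2 h3)].

End Extension.

Definition ext_inj (F : fieldType) (V W : lmodType F) (h : W) : V * W := (0, h).

Definition ext_proj (F : fieldType) (V W : lmodType F) (a : V * W) : V := a.1.

Definition map3 (S T : Type) (f : S -> T) (t : S * S * S) : T * T * T :=
  let: (x, y, z) := t in (f x, f y, f z).

Definition extends_to_derivation (F : fieldType) (V W : lmodType F)
    (A : threeLie (V * W)%type) (sigma : V -> V) (tau : W -> W) : Prop :=
  exists delta : V * W -> V * W,
    [/\ is_derivation A delta,
        delta \o @ext_inj F V W =1 @ext_inj F V W \o tau
      & @ext_proj F V W \o delta =1 sigma \o @ext_proj F V W].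

Definition extends_to_hom (F : fieldType) (V W : lmodType F)
    (A : threeLie (V * W)%type)
    (fsigma : V -> V * V * V) (ftau : W -> W * W * W) : Prop :=
  exists g : V * W -> (V * W) * (V * W) * (V * W),
    [/\ is_threeLie_hom A (triple A) g,
        g \o @ext_inj F V W =1 map3 (@ext_inj F V W) \o ftau
      & map3 (@ext_proj F V W) \o g =1 fsigma \o @ext_proj F V W].

(* Main.v *)
Require Import Defs.
From mathcomp Require Import all_boot all_order all_algebra.
Set Implicit Arguments.
Unset Strict Implicit.
Unset Printing Implicit Defensive.
Import GRing.Theory.
Local Open Scope ring_scope.

(** The second component [g2] of an extension [g = (g1, g2, g3)] is an
    endomorphism of [A] inducing the identity on [H] and on [A / H]. Hence
    [g2 - id] squares to zero and [g2] is invertible with inverse [2 id - g2].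
    The first component satisfies
    [g1 [a, b, c] = [g1 a, g2 b, g2 c] + [g2 a, g1 b, g2 c] + [g2 a, g2 b, g1 c]],
    so [g2^-1 \o g1] is a derivation; it extends [(sigma, tau)] because [g2^-1]
    also induces the identity on [H] and on [A / H]. Conversely a derivation
    [delta] extending [(sigma, tau)] yields [g = f_delta]. *)

Lemma linear_additive (F : fieldType) (U V : lmodType F) (f : U -> V) :
  linear f -> {morph f : x y / x + y}.
Proof. by move=> fL x y; have := fL 1 x y; rewrite !scale1r. Qed.

Lemma linear_sub (F : fieldType) (U V : lmodType F) (f : U -> V) :
  linear f -> {morph f : x y / x - y}.
Proof.
move=> fL x y; apply: (@addIr _ (f y)).
by rewrite -(linear_additive fL) !subrK.
Qed.

Lemma bracket_cycle (F : fieldType) (V : lmodType F) (B : threeLie V) x y z :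
  B x y z = B y z x.
Proof. by case: (bracket_skew B) => s12 s23; rewrite s12 s23 opprK. Qed.

Section HomToTriple.
Variables (F : fieldType) (V : lmodType F) (B : threeLie V).
Variable g : V -> V * V * V.
Hypothesis g_hom : is_threeLie_hom B (triple B) g.

Lemma hom_triple_linear1 : linear (fun a => (g a).1.1).
Proof. by case: g_hom => gL _ k x y; rewrite gL. Qed.

Lemma hom_triple_linear2 : linear (fun a => (g a).1.2).
Proof. by case: g_hom => gL _ k x y; rewrite gL. Qed.

(** The bracket of [triple B] lists its arguments in rotated order; cyclic invariance of [B] puts
    each back in its own slot, giving a Leibniz rule twisted by the second component. *)
Lemma hom_triple_bracket1 x y z :
  (g (B x y z)).1.1 = B (g x).1.1 (g y).1.2 (g z).1.2
    + B (g x).1.2 (g y).1.1 (g z).1.2 + B (g x).1.2 (g y).1.2 (g z).1.1.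
Proof.
case: g_hom => _ ->.
case: (g x) (g y) (g z) => [[x1 x2] x3] [[y1 y2] y3] [[z1 z2] z3] /=.
by rewrite (bracket_cycle B x2 y1) (bracket_cycle B x2 y2)
  (bracket_cycle B y2 z1).
Qed.

Lemma hom_triple_bracket2 x y z :
  (g (B x y z)).1.2 = B (g x).1.2 (g y).1.2 (g z).1.2.
Proof.
case: g_hom => _ ->.
by case: (g x) (g y) (g z) => [[x1 x2] x3] [[y1 y2] y3] [[z1 z2] z3].
Qed.

Lemma hom_triple_derivation (k : V -> V) :
  linear k -> cancel (fun a => (g a).1.2) k -> cancel k (fun a => (g a).1.2) ->
  is_derivation B (fun a => k (g a).1.1).
Proof.
move=> kL gK kK; split=> [c x y | x y z].
  by rewrite hom_triple_linear1 kL.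
rewrite hom_triple_bracket1 !(linear_additive kL).
(* Writing each first component as the second component of [g] at its image under [k] makes every
   summand [k] of a bracket of second components, which collapses by multiplicativity and [gK]. *)
rewrite -[in LHS](kK (g x).1.1) -[in LHS](kK (g y).1.1) -[in LHS](kK (g z).1.1).
by rewrite -!hom_triple_bracket2 !gK.
Qed.

End HomToTriple.

Lemma derivation_extends_hom (F : fieldType) (V W : lmodType F)
    (A : threeLie (V * W)%type) (sigma : V -> V) (tau : W -> W) :
  extends_to_derivation A sigma tau ->
  extends_to_hom A (f_der sigma) (f_der tau).
Proof.
case=> delta [dA di pd]; exists (f_der delta); split.
- exact: f_der_hom.
- by move=> h; rewrite /f_der /=; move: (di h) => /= ->.
- by move=> a; rewrite /f_der /=; move: (pd a) => /= ->.
Qed.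

Lemma hom_extends_derivation (F : fieldType) (V W : lmodType F)
    (A : threeLie (V * W)%type) (sigma : V -> V) (tau : W -> W) :
  extends_to_hom A (f_der sigma) (f_der tau) ->
  extends_to_derivation A sigma tau.
Proof.
case=> g [g_hom gi pg].
pose g2 a := (g a).1.2; pose k a := a - (g2 a - a).
have g2L : linear g2 := hom_triple_linear2 g_hom.
have g1i h : (g (0, h)).1.1 = (0, tau h).
  by have := gi h; rewrite /= /ext_inj => ->.
have g2i h : g2 (0, h) = (0, h).
  by have := gi h; rewrite /= /ext_inj /g2 => ->.
have pg1 a : (g a).1.1.1 = sigma a.1.
  by have := pg a; rewrite /= /ext_proj; case: (g a) => [[? ?] ?] [].
have pg2 a : (g2 a).1 = a.1.
  by have := pg a; rewrite /= /ext_proj /g2; case: (g a) => [[? ?] ?] [].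
(* Since [g2] preserves the [V]-coordinate, [g2 a - a] lies in the copy of [W], which [g2] fixes
   pointwise. *)
have g2_fix a : g2 (g2 a - a) = g2 a - a.
  have -> : g2 a - a = (0, (g2 a - a).2).
    by rewrite [LHS]surjective_pairing /= pg2 subrr.
  exact: g2i.
have kK : cancel k g2.
  by move=> a; rewrite /k (linear_sub g2L) g2_fix opprB addrC subrK.
have g2K : cancel g2 k.
  by move=> a; rewrite /k -(linear_sub g2L) g2_fix opprB addrC subrK.
(* Linearity passes from [g2] to its two-sided inverse. *)
have kL : linear k.
  by move=> c x y; rewrite -[in LHS](kK x) -[in LHS](kK y) -g2L g2K.
exists (fun a => k (g a).1.1); split.
- exact: hom_triple_derivation.
- by move=> h; rewrite /= /ext_inj g1i /k g2i subrr subr0.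
- by move=> a; rewrite /= /ext_proj /k /= pg2 subrr subr0 pg1.
Qed.

Theorem theorem4p10 (F : fieldType) (hF : 2%N \notin [pchar F])
    (V W : lmodType F) (M : threeLie V) (H : threeLie W)
    (E : extData V H) (A : threeLie (V * W)%type) (hA : is_extension M E A)
    (sigma : V -> V) (tau : W -> W)
    (hsigma : is_derivation M sigma) (htau : is_derivation H tau) :
  extends_to_derivation A sigma tau
  <-> extends_to_hom A (f_der sigma) (f_der tau).
Proof.
split; [exact: derivation_extends_hom | exact: hom_extends_derivation].
Qed.
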